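(* Let $(R,\mathfrak{m})$ be a Noetherian local ring and let $cl$ be a Nakayama closure on ideals of $R$. Then for any ideal $I$ of $R$ and any $cl$-reduction $J$ of $I$, there is a minimal $cl$-reduction $K$ of $I$ contained in $J$. Moreover, in this situation (that is, whenever $K$ is a minimal $cl$-reduction of $I$ contained in the $cl$-reduction $J$ of $I$), any minimal generating set of $K$ extends to a minimal generating set of $J$.
   Context: A closure operation $cl$ on ideals of $R$ assigns to each ideal $I$ an ideal $I^{cl}$ such that $I\subseteq I^{cl}=(I^{cl})^{cl}$, and such that $J\subseteq I$ implies $J^{cl}\subseteq I^{cl}$ for all ideals $I,J$. It is a Nakayama closure if for any ideals $I$ and $J$ such that $J\subseteq I\subseteq(J+\mathfrak{m}I)^{cl}$, it follows that $I\subseteq J^{cl}$. An ideal $J$ is a $cl$-reduction of $I$ if $J\subseteq I\subseteq J^{cl}$; it is a minimal $cl$-reduction of $I$ if it is minimal with respect to inclusion among the $cl$-reductions of $I$. *)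

(* Defs.v *)
From mathcomp Require Import all_boot all_algebra.
From mathcomp Require Import boolp classical_sets.

Set Implicit Arguments.
Unset Strict Implicit.
Unset Printing Implicit Defensive.

Import GRing.Theory.
Local Open Scope ring_scope.
Local Open Scope classical_set_scope.

(* MathComp's [idealr] only covers decidable proper ideals; here ideals are
   arbitrary sets and the unit ideal is allowed. *)
Definition is_ideal (R : comNzRingType) (I : set R) : Prop :=
  [/\ I 0,
      forall x y, I x -> I y -> I (x + y)
    & forall a x, I x -> I (a * x)].

Definition ideal_gen (R : comNzRingType) (S : set R) : set R :=
  smallest (@is_ideal R) S.

Definition ideal_add (R : comNzRingType) (I J : set R) : set R :=
  [set x + y | x in I & y in J].

Definition ideal_mul (R : comNzRingType) (I J : set R) : set R :=
  ideal_gen [set x * y | x in I & y in J].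

Definition noetherian (R : comNzRingType) : Prop :=
  forall I : set R, is_ideal I -> exists s : seq R, I = ideal_gen [set` s].

Definition maximal_ideal (R : comNzRingType) (m : set R) : Prop :=
  [/\ is_ideal m, m <> setT
    & forall I : set R, is_ideal I -> m `<=` I -> I = m \/ I = setT].

Definition local_ring (R : comNzRingType) (m : set R) : Prop :=
  maximal_ideal m /\ forall n : set R, maximal_ideal n -> n = m.

(* A closure operation is given by a function on all subsets of R, of which only
   the restriction to ideals matters. *)
Definition closure_operation (R : comNzRingType) (cl : set R -> set R) : Prop :=
  [/\ forall I, is_ideal I -> is_ideal (cl I),
      forall I, is_ideal I -> I `<=` cl I,
      forall I, is_ideal I -> cl (cl I) = cl I
    & forall I J, is_ideal I -> is_ideal J -> J `<=` I -> cl J `<=` cl I].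

Definition nakayama_closure (R : comNzRingType) (m : set R)
    (cl : set R -> set R) : Prop :=
  closure_operation cl /\
  forall I J, is_ideal I -> is_ideal J ->
    J `<=` I -> I `<=` cl (ideal_add J (ideal_mul m I)) -> I `<=` cl J.

Definition cl_reduction (R : comNzRingType) (cl : set R -> set R)
    (J I : set R) : Prop :=
  [/\ is_ideal J, J `<=` I & I `<=` cl J].

Definition minimal_cl_reduction (R : comNzRingType) (cl : set R -> set R)
    (K I : set R) : Prop :=
  cl_reduction cl K I /\
  forall L : set R, cl_reduction cl L I -> L `<=` K -> L = K.

Definition minimal_generating_set (R : comNzRingType) (S I : set R) : Prop :=
  ideal_gen S = I /\
  forall T : set R, T `<=` S -> ideal_gen T = I -> T = S.

(* Main.v *)
Require Import Defs.
From mathcomp Require Import all_boot all_algebra.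
From mathcomp Require Import boolp classical_sets.
From mathcomp Require Import ring.
Local Open Scope classical_set_scope.

(** Among the lists of elements of [J] that generate a [cl]-reduction of [I], take
  one, [s], of least length, and let [K = (s)].  If [L] is a [cl]-reduction
  contained in [K], row reduction over the residue field yields a list [t] in [L]
  with [L] contained in [(t) + mK] and either [t] shorter than [s] or
  [K] contained in [L + mK].  The former is excluded, since [(t)] is a
  [cl]-reduction by the Nakayama property of [cl]; in the latter case [K = L] by
  the usual Nakayama lemma.

  For the second part, add to [S] a list [t] of least length such that [S] and [t]
  generate [J].  A redundant element would have to be some [x] in [S], and [x]
  would lie in [(S \ x) + mJ], because a unit coefficient on an element of [t]
  would make that element superfluous.  Then [K] is contained in
  [(S \ x) + mI], so [(S \ x)] is a [cl]-reduction, hence equals [K] by minimality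
  of [K], against the minimality of [S]. *)

Section Ideals.
Set Implicit Arguments.
Unset Strict Implicit.
Import GRing.Theory.
Local Open Scope ring_scope.

Variable R : comNzRingType.
Implicit Types (m I J K L N S T : set R) (cl : set R -> set R) (s t : seq R).

(** * Ideals, generated ideals and sums of ideals *)

Lemma ideal0 I : is_ideal I -> I 0. Proof. by case. Qed.

Lemma idealD I x y : is_ideal I -> I x -> I y -> I (x + y).
Proof. by case=> _ + _; apply. Qed.

Lemma idealM I a x : is_ideal I -> I x -> I (a * x).
Proof. by case=> _ _; apply. Qed.

Lemma idealB I x y : is_ideal I -> I x -> I y -> I (x - y).
Proof. by move=> hI Ix Iy; rewrite -mulN1r; apply: idealD => //; apply: idealM. Qed.

Lemma is_idealT : is_ideal [set: R]. Proof. by split. Qed.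

Lemma is_ideal_gen S : is_ideal (ideal_gen S).
Proof.
split=> [I [/ideal0]//|x y Gx Gy I hI|a x Gx I hI].
  by apply: idealD; [case: hI|exact: Gx|exact: Gy].
by apply: idealM; [case: hI|exact: Gx].
Qed.

Lemma sub_ideal_gen S : S `<=` ideal_gen S.
Proof. exact: sub_smallest. Qed.

Lemma ideal_gen_sub S I : is_ideal I -> S `<=` I -> ideal_gen S `<=` I.
Proof. exact: smallest_sub. Qed.

Lemma ideal_genS S T : S `<=` T -> ideal_gen S `<=` ideal_gen T.
Proof.
move=> ST; apply: ideal_gen_sub (is_ideal_gen T) _.
exact: subset_trans ST (@sub_ideal_gen T).
Qed.

Lemma is_ideal_add I J : is_ideal I -> is_ideal J -> is_ideal (ideal_add I J).
Proof.
move=> hI hJ; split=> [|_ _ [x Ix [y Jy <-]] [x' Ix' [y' Jy' <-]]|a _ [x Ix [y Jy <-]]].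
- by exists 0; [exact: ideal0|exists 0; [exact: ideal0|rewrite addr0]].
- by rewrite addrACA; exists (x + x'); [exact: idealD|exists (y + y') => //; exact: idealD].
- by rewrite mulrDr; exists (a * x); [exact: idealM|exists (a * y) => //; exact: idealM].
Qed.

Lemma ideal_addl I J : is_ideal J -> I `<=` ideal_add I J.
Proof. by move=> /ideal0 J0 x Ix; exists x => //; exists 0; rewrite ?addr0. Qed.

Lemma ideal_addr I J : is_ideal I -> J `<=` ideal_add I J.
Proof. by move=> /ideal0 I0 x Jx; exists 0 => //; exists x; rewrite ?add0r. Qed.

Lemma ideal_add_sub I J L :
  is_ideal L -> I `<=` L -> J `<=` L -> ideal_add I J `<=` L.
Proof. by move=> hL IL JL _ [x /IL Lx [y /JL Ly <-]]; apply: idealD. Qed.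

(** * Maximal ideals and units of a local ring *)

(** Zorn's lemma for the ideals that contain [I] but not 1: the union of a nonempty chain of these
    is again one. *)
Lemma exists_maximal_ideal I :
  is_ideal I -> I <> setT -> exists2 n, maximal_ideal n & I `<=` n.
Proof.
move=> hI IT.
have properE L : is_ideal L -> L <> setT -> ~ L 1.
  move=> hL LT L1; apply: LT; apply/seteqP; split=> // x _.
  by rewrite -(mulr1 x); apply: idealM.
(* [set0] is only there for the union of the empty chain *)
pose P L := L = set0 \/ [/\ is_ideal L, ~ L 1 & I `<=` L].
have [F FP Ftot|n [Pn nmax]] := @Zorn_bigcup R P.
  have FE L x : F L -> L x -> [/\ is_ideal L, ~ L 1 & I `<=` L].
    by move=> /FP[->|].
  have [[L0 [x0 [FL0 L0x0]]]|F0] := pselect (exists L x, F L /\ L x); last first.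
    by left; apply/seteqP; split=> // x [L FL Lx]; apply: F0; exists L, x.
  have [hL0 L01 IL0] := FE _ _ FL0 L0x0.
  right; split; [split| |].
  - by exists L0 => //; exact: ideal0.
  - move=> x y [L FL Lx] [L' FL' Ly].
    have [hL _ _] := FE _ _ FL Lx; have [hL' _ _] := FE _ _ FL' Ly.
    have [LL'|L'L] := Ftot _ _ FL FL'.
      by exists L' => //; apply: idealD => //; exact: LL'.
    by exists L => //; apply: idealD => //; exact: L'L.
  - move=> a x [L FL Lx]; have [hL _ _] := FE _ _ FL Lx.
    by exists L => //; exact: idealM.
  - by case=> L FL L1; have [_ /(_ L1)] := FE _ _ FL L1.
  - by move=> x /IL0 L0x; exists L0.
have PI : P I by right; split => //; exact: properE.
have [hn n1 In] : [/\ is_ideal n, ~ n 1 & I `<=` n].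
  (* The empty set is not maximal for [P]: it is strictly contained in [I]. *)
  case: Pn => // -> in nmax *; exfalso; apply: (nmax I) PI.
  by split=> // I0; exact: I0 (ideal0 hI).
exists n => //; split=> //; first by move=> nT; apply: n1; rewrite nT.
move=> L hL nL; have [->|LT] := pselect (L = setT); first by right.
left; apply: contrapT => Ln; apply: (nmax L).
  by split=> // Ln'; apply: Ln; apply/seteqP.
by right; split=> //; [exact: properE|exact: subset_trans nL].
Qed.

(** The multiples of a nonunit [u] form a proper ideal, so they lie in some maximal ideal, which can
    only be [m]. *)
Lemma local_ring_unit m u : local_ring m -> ~ m u -> exists v, v * u = 1.
Proof.
move=> [_ muniq] mu; pose I := [set v * u | v in [set: R]].
have [[v _ vu]|I1] := pselect (I 1); first by exists v.
have hI : is_ideal I.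
  split=> [|_ _ [v _ <-] [w _ <-]|a _ [v _ <-]].
  - by exists 0; rewrite ?mul0r.
  - by exists (v + w); rewrite ?mulrDl.
  - by exists (a * v); rewrite ?mulrA.
have [|n /muniq -> In] := exists_maximal_ideal hI.
  by move=> IT; apply: I1; rewrite IT.
by exfalso; apply/mu/In; exists 1; rewrite ?mul1r.
Qed.

Lemma local_ring_ideal m : local_ring m -> is_ideal m.
Proof. by case=> -[]. Qed.

Lemma local_ring_1 m : local_ring m -> ~ m 1.
Proof.
case=> -[hm mT _] _ m1; apply: mT; apply/seteqP; split=> // x _.
by rewrite -(mulr1 x); apply: idealM.
Qed.

(** * Linear combinations of a list *)

(** For [A = setT] this is the ideal (s), for [A = m] it is m(s). The recursion splits off one
    generator at a time, as elimination requires. *)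
Fixpoint comb (A : set R) s : set R :=
  if s is y :: s' then [set a * y + z | a in A & z in comb A s'] else [set 0].

Lemma is_ideal_comb A s : is_ideal A -> is_ideal (comb A s).
Proof.
move=> hA; elim: s => [|y s IHs] /=.
  by split=> // [x y -> ->|a x ->]; rewrite ?addr0 ?mulr0.
split=> [|_ _ [a Aa [z sz <-]] [b Ab [w sw <-]]|c _ [a Aa [z sz <-]]].
- by exists 0; [exact: ideal0|exists 0; [exact: ideal0|rewrite mul0r addr0]].
- rewrite addrACA -mulrDl; exists (a + b); first exact: idealD.
  by exists (z + w) => //; exact: idealD.
- rewrite mulrDr mulrA; exists (c * a); first exact: idealM.
  by exists (c * z) => //; exact: idealM.
Qed.

Lemma comb_sub A s I :
  is_ideal I -> (forall a y, A a -> y \in s -> I (a * y)) -> comb A s `<=` I.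
Proof.
move=> hI; elim: s => [|y s IHs] sI /=; first by move=> _ ->; exact: ideal0.
move=> _ [a Aa [z sz <-]]; apply: idealD => //.
  by apply: sI; rewrite ?mem_head.
by apply: IHs sz => b x Ab sx; apply: sI => //; rewrite inE sx orbT.
Qed.

Lemma mem_comb A s a y : is_ideal A -> A a -> y \in s -> comb A s (a * y).
Proof.
move=> hA Aa; elim: s => // x s IHs; rewrite inE => /orP[/eqP ->|/IHs sy] /=.
  by exists a => //; exists 0; [exact: ideal0 (is_ideal_comb s hA)|rewrite addr0].
by exists 0; [exact: ideal0|exists (a * y); rewrite ?mul0r ?add0r].
Qed.

Lemma ideal_gen_seq s : ideal_gen [set` s] = comb setT s.
Proof.
apply/seteqP; split.
  apply: ideal_gen_sub; first exact: is_ideal_comb is_idealT.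
  by move=> x /= sx; rewrite -(mul1r x); apply: mem_comb => //; exact: is_idealT.
apply: comb_sub (is_ideal_gen _) _ => a y _ sy.
by apply: idealM (is_ideal_gen _) _; exact: sub_ideal_gen.
Qed.

Lemma ideal_genU S T :
  ideal_gen (S `|` T) = ideal_add (ideal_gen S) (ideal_gen T).
Proof.
have hS := is_ideal_gen S; have hT := is_ideal_gen T.
apply/seteqP; split.
  apply: ideal_gen_sub; first exact: is_ideal_add.
  move=> x [] /(@sub_ideal_gen _); first exact: ideal_addl.
  exact: ideal_addr.
apply: ideal_add_sub; first exact: is_ideal_gen.
  by apply: ideal_genS; exact: subsetUl.
by apply: ideal_genS; exact: subsetUr.
Qed.

(** Either all coefficients can be taken in [m], or a term with a coefficient outside [m] is
    isolated from the rest. *)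
Lemma comb_local m s z : comb setT s z ->
  comb m s z \/ exists s1 y s2, s = s1 ++ y :: s2 /\
    exists u w, [/\ ~ m u, comb setT (s1 ++ s2) w & z = u * y + w].
Proof.
elim: s z => [|y s IHs] z /=; first by left.
case=> a _ [w sw <-]; have [ma|ma] := pselect (m a); last first.
  by right; exists [::], y, s; split=> //; exists a, w.
case: (IHs _ sw) => [mw|[s1 [x [s2 [-> [u [v [mu sv ->]]]]]]]].
  by left; exists a => //; exists w.
right; exists (y :: s1), x, s2; split=> //; exists u, (a * y + v); split=> //=.
  by exists a => //; exists v.
by rewrite addrCA.
Qed.

(** * Row reduction and Nakayama's lemma *)

(* Row reduction of [L] modulo [N], with the elements of [t] as pivot rows. *)
Lemma row_reduction m s N L : local_ring m -> is_ideal N -> is_ideal L ->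
    (forall a y, m a -> y \in s -> N (a * y)) ->
    L `<=` ideal_add (comb setT s) N ->
  exists t, [/\ [set` t] `<=` L, L `<=` ideal_add (comb setT t) N,
    (size t <= size s)%N &
    (size t < size s)%N \/ comb setT s `<=` ideal_add L N].
Proof.
move=> hm hN; elim: s L => [|y s IHs] L hL mN Ls.
  exists [::]; split=> //; right=> _ ->.
  by apply: ideal0; exact: is_ideal_add.
have hs := is_ideal_comb s is_idealT.
(* Induction is applied to the elements of [L] that can be written without [y] modulo [N]. *)
pose L' := L `&` ideal_add (comb setT s) N.
have hsN := is_ideal_add hs hN.
have hL' : is_ideal L'.
  split=> [|x z [Lx sx] [Lz sz]|a x [Lx sx]]; split.
  - exact: ideal0.
  - exact: ideal0.
  - exact: idealD.
  - exact: idealD.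
  - exact: idealM.
  - exact: idealM.
have [|x [_ //]|t [tL L't ts tlt]] := IHs L' hL'.
  by move=> a z ma sz; apply: mN => //; rewrite inE sz orbT.
(* If [L'] is all of [L], then [y] needs no pivot and [t] is shorter than [y :: s]. *)
have [LL'|] := pselect (L `<=` ideal_add (comb setT s) N).
  exists t; split.
  - by move=> x /tL[].
  - by move=> x Lx; apply: L't; split=> //; exact: LL'.
  - exact: leq_trans ts _.
  - by left.
move=> /existsNP[l /not_implyP[Ll sl]].
have /= [_ [a _ [z sz <-]] [n Nn lE]] := Ls _ Ll.
(* If [a] were in [m], then [a * y] would be absorbed by [N], and [l] would not need [y]. So [a] is
   a unit, and [l] becomes the pivot row for [y]. *)
have ma : ~ m a.
  move=> ma; apply: sl; exists z => //; exists (a * y + n).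
    by apply: idealD => //; apply: mN; rewrite ?mem_head.
  by rewrite -lE; ring.
have [v va] := local_ring_unit hm ma.
exists (l :: t); split=> //=.
- by move=> x /=; rewrite inE => /orP[/eqP ->//|/tL[]].
- move=> x Lx; have /= [_ [b _ [w sw <-]] [k Nk xE]] := Ls _ Lx.
  (* As [v * a = 1], subtracting this multiple of the pivot row clears the coefficient [b] of
     [y]. *)
  have : L' (x - b * v * l).
    split; first by apply: idealB => //; exact: idealM.
    exists (w - b * v * z); first by apply: idealB => //; exact: idealM.
    exists (k - b * v * n); first by apply: idealB => //; exact: idealM.
    rewrite -xE -lE.
    have -> : b * y + w + k - b * v * (a * y + z + n) =
      b * y * (1 - v * a) + (w - b * v * z + (k - b * v * n)) by ring.
    by rewrite va subrr mulr0 add0r.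
  move=> /L't[p tp [q Nq pqE]]; exists (b * v * l + p).
    by exists (b * v) => //; exists p.
  by exists q => //; rewrite -addrA pqE; ring.
- case: tlt => [|sL']; [by left|right].
  have hLN := is_ideal_add hL hN.
  have sLN : comb setT s `<=` ideal_add L N.
    by apply: subset_trans sL' _; move=> _ [p [Lp _] [q Nq <-]]; exists p => //; exists q.
  have yLN : ideal_add L N y.
    have -> : y = v * (l - z - n) + (1 - v * a) * y by rewrite -lE; ring.
    rewrite va subrr mul0r addr0; apply: idealM => //.
    apply: idealB => //; last exact: ideal_addr.
    by apply: idealB => //; [exact: ideal_addl|exact: sLN].
  move=> _ [b _ [w sw <-]]; apply: idealD => //; last exact: sLN.
  exact: idealM.
Qed.

(** Elimination one generator at a time: the coefficient [a] of [y] on the right is in [m], so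
    [1 - a] is a unit and [y] can be solved for and substituted into the relations for the other
    generators. *)
Lemma nakayama_seq m s L : local_ring m -> is_ideal L ->
  [set` s] `<=` ideal_add L (comb m s) -> [set` s] `<=` L.
Proof.
move=> hm hL; have hmi := local_ring_ideal hm.
elim: s => [|y s IHs] sL; first by [].
have hs := is_ideal_comb s hmi.
have hLs := is_ideal_add hL hs.
have ys : ideal_add L (comb m s) y.
  have /= [|l Ll [_ [a ma [z sz <-]] yE]] := sL y; first exact: mem_head.
  have [v v1a] : exists v, v * (1 - a) = 1.
    apply: (local_ring_unit hm) => m1a; apply: (local_ring_1 hm).
    by rewrite -(subrK a 1); apply: idealD.
  have -> : y = v * (l + z).
    have -> : l + z = (1 - a) * y + (l + (a * y + z) - y) by ring.
    by rewrite yE subrr addr0 mulrA v1a mul1r.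
  by apply: idealM => //; exists l => //; exists z.
have {}IHs : [set` s] `<=` L.
  apply: IHs => x /= sx; have /= := sL x; rewrite inE sx orbT => /(_ isT).
  case=> l Ll [_ [a ma [z sz <-]] <-].
  apply: idealD => //; first exact: ideal_addl.
  by apply: idealD => //; [exact: idealM|exact: ideal_addr].
move=> x /=; rewrite inE => /orP[/eqP ->|/IHs//].
move: ys; apply: ideal_add_sub => //.
by apply: comb_sub => // a z _ sz; apply: idealM => //; exact: IHs.
Qed.

(** * Minimal reductions and their generating sets *)

Lemma exists_min_size (P : set (seq R)) : (exists s, P s) ->
  exists2 s, P s & forall t, P t -> (size s <= size t)%N.
Proof.
move=> [s0 Ps0].
have ex : exists n, `[< exists2 s, P s & size s = n >].
  by exists (size s0); apply/asboolP; exists s0.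
case: (ex_minnP ex) => _ /asboolP[s Ps <-] smin; exists s => // t Pt.
by apply: smin; apply/asboolP; exists t.
Qed.

(** By monotonicity, [I] lies in [cl L], hence in the closure of L' + mI, and the Nakayama property
    of [cl] applies. *)
Lemma cl_reduction_nakayama m cl I L L' : nakayama_closure m cl ->
    is_ideal I -> cl_reduction cl L I -> is_ideal L' -> L' `<=` I ->
    L `<=` ideal_add L' (ideal_mul m I) -> cl_reduction cl L' I.
Proof.
move=> [[_ _ _ clS] clN] hI [hL LI IL] hL' L'I LL'.
split=> //; apply: clN => //; apply: subset_trans IL _; apply: clS => //.
exact: is_ideal_add (is_ideal_gen _).
Qed.

Lemma comb_ideal_mul m s I : [set` s] `<=` I -> comb m s `<=` ideal_mul m I.
Proof.
move=> sI; apply: comb_sub (is_ideal_gen _) _ => a y ma sy.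
by apply: sub_ideal_gen; exists a => //; exists y => //; exact: sI.
Qed.

Lemma exists_minimal_cl_reduction m cl I J : noetherian R -> local_ring m ->
    nakayama_closure m cl -> is_ideal I -> cl_reduction cl J I ->
  exists K, minimal_cl_reduction cl K I /\ K `<=` J.
Proof.
move=> hnoeth hm hcl hI hJ; have [hJi JI _] := hJ.
have [|s [sJ sred] smin] := @exists_min_size
    [set s : seq R | [set` s] `<=` J /\ cl_reduction cl (comb setT s) I].
  have [s sE] := hnoeth _ hJi; exists s; split; rewrite -?ideal_gen_seq -?sE //.
  by rewrite sE; exact: sub_ideal_gen.
exists (comb setT s); split; last first.
  by rewrite -ideal_gen_seq; exact: ideal_gen_sub.
split=> // L hL Ls; have [hLi LI _] := hL.
have hN := is_ideal_comb s (local_ring_ideal hm).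
have sI : [set` s] `<=` I := subset_trans sJ JI.
have LsN : L `<=` ideal_add (comb setT s) (comb m s).
  by apply: subset_trans Ls _; exact: ideal_addl.
have mN a y : m a -> y \in s -> comb m s (a * y).
  by move=> ma sy; apply: mem_comb => //; exact: local_ring_ideal.
(* Reducing modulo [comb m s], which is mK for K = (s), gives the second outcome the form that
   [nakayama_seq] takes. *)
have [t [tL Lt _ [tlt|sL]]] := row_reduction hm hN hLi mN LsN.
  have tred : cl_reduction cl (comb setT t) I.
    apply: (cl_reduction_nakayama hcl hI hL).
    - exact: is_ideal_comb is_idealT.
    - by rewrite -ideal_gen_seq; apply: ideal_gen_sub => //; exact: subset_trans tL LI.
    - move=> _ /Lt[x tx [y sy <-]]; exists x => //; exists y => //.
      exact: comb_ideal_mul sy.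
  have := smin t; rewrite leqNgt tlt => tmin; suff: false by [].
  apply: tmin; split=> // x /tL /Ls; rewrite -ideal_gen_seq.
  exact: ideal_gen_sub.
apply/seteqP; split=> //; rewrite -ideal_gen_seq; apply: ideal_gen_sub => //.
apply: nakayama_seq hm hLi _; apply: subset_trans sL.
by rewrite -ideal_gen_seq; exact: sub_ideal_gen.
Qed.

Lemma extend_minimal_generating_set m cl I J K S :
    noetherian R -> local_ring m -> nakayama_closure m cl -> is_ideal I ->
    is_ideal J -> J `<=` I -> minimal_cl_reduction cl K I -> K `<=` J ->
    minimal_generating_set S K ->
  exists T, S `<=` T /\ minimal_generating_set T J.
Proof.
move=> hnoeth hm hcl hI hJ JI [Kred Kmin] KJ [SK Smin].
have SJ : S `<=` J by apply: subset_trans KJ; rewrite -SK; exact: sub_ideal_gen.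
have [|t tJ tmin] := @exists_min_size [set t : seq R | ideal_gen (S `|` [set` t]) = J].
  have [s sE] := hnoeth _ hJ; exists s; apply/seteqP; split.
    by apply: ideal_gen_sub => // x [/SJ//|]; rewrite sE; exact: sub_ideal_gen.
  by rewrite {1}sE; apply: ideal_genS; exact: subsetUr.
exists (S `|` [set` t]); split; first exact: subsetUl.
split=> // T Tt TJ; apply/seteqP; split=> //.
have hSt t' := is_ideal_gen (S `|` [set` t']).
have tsub : [set` t] `<=` J.
  by rewrite -[J]tJ; apply: subset_trans (@sub_ideal_gen _); exact: subsetUr.
(* Otherwise [y] could be dropped from [t], against its least length. *)
have irr t1 y t2 : t = t1 ++ y :: t2 -> ~ ideal_gen (S `|` [set` t1 ++ t2]) y.
  move=> tE yt; have := tmin (t1 ++ t2).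
  rewrite tE !size_cat /= addnS ltnn => tmin'; suff: false by [].
  apply: tmin'; apply/seteqP; split.
    apply: ideal_gen_sub => // x [/SJ//|xt]; apply: tsub.
    by move: xt; rewrite /= tE !mem_cat inE => /orP[->|->]; rewrite ?orbT.
  rewrite -[J]tJ; apply: ideal_gen_sub => // x [Sx|].
    by apply: sub_ideal_gen; left.
  rewrite /= tE mem_cat inE orbCA => /orP[/eqP ->//|xt].
  by apply: sub_ideal_gen; right; rewrite /= mem_cat.
move=> x xSt; apply: contrapT => Tx.
have Jx : J x by case: xSt => [/SJ|/tsub].
(* An [x] in [t] missing from [T] would be generated by [S] and the other elements of [t], against
   [irr]. *)
have [xt|xt] := boolP (x \in t).
  have [t1 [t2 tE]] : exists t1 t2, t = t1 ++ x :: t2.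
    by case/path.splitPr: xt => t1 t2; exists t1, t2.
  apply: (irr _ _ _ tE); move: Jx; rewrite -[J]TJ; apply: ideal_genS => y Ty.
  case: (Tt y Ty) => [|/=]; [by left|rewrite tE mem_cat inE orbCA].
  by case/orP => [/eqP yx|yt]; [rewrite yx in Ty|right; rewrite /= mem_cat].
have Sx : S x by case: xSt => //= xt'; rewrite xt' in xt.
have hSx := is_ideal_gen (S `\ x).
(* Since [T] omits [x], it lies in the union of [S \ x] and [t], and it generates [J], which
   contains [x]. *)
have Txt : ideal_add (ideal_gen (S `\ x)) (comb setT t) x.
  rewrite -ideal_gen_seq -ideal_genU; move: Jx; rewrite -[J]TJ.
  apply: ideal_genS => y Ty; have [Sy|] := Tt y Ty; last by right.
  by left; split=> //= yx; apply: Tx; rewrite -yx.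
have Sxmt : ideal_add (ideal_gen (S `\ x)) (comb m t) x.
  case: Txt => g Sg [z tz gzE].
  case: (comb_local m tz) => [mz|[t1 [y [t2 [tE [u [w [mu tw zE]]]]]]]].
    by exists g => //; exists z.
  have [v vu] := local_ring_unit hm mu.
  case: (irr _ _ _ tE).
  have -> : y = v * (x - g - w).
    have -> : x - g - w = u * y by rewrite -gzE zE; ring.
    by rewrite mulrA vu mul1r.
  apply: idealM (hSt _) _; apply: idealB (hSt _) _ _.
    apply: idealB (hSt _) _ _; first by apply: sub_ideal_gen; left.
    by apply: ideal_genS Sg => y' [Sy' _]; left.
  rewrite -ideal_gen_seq in tw; apply: ideal_genS tw; exact: subsetUr.
have hmI : is_ideal (ideal_mul m I) by exact: is_ideal_gen.
have SxI : ideal_gen (S `\ x) `<=` K.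
  by rewrite -[K]SK; apply: ideal_genS; exact: subDsetl.
have [_ KI _] := Kred.
(* Only the generator [x] of [K] needs the second summand; its part in m(t) lies in mI because [t]
   is contained in [J], hence in [I]. *)
have KSx : K `<=` ideal_add (ideal_gen (S `\ x)) (ideal_mul m I).
  rewrite -[K]SK; apply: ideal_gen_sub; first exact: is_ideal_add.
  move=> y Sy; have [->|yx] := pselect (y = x); last first.
    by apply: ideal_addl => //; apply: sub_ideal_gen.
  case: Sxmt => g Sg [z mz gzE]; exists g => //; exists z => //.
  by apply: comb_ideal_mul mz; exact: subset_trans JI.
have /Kmin/(_ SxI) : cl_reduction cl (ideal_gen (S `\ x)) I.
  by apply: (cl_reduction_nakayama hcl hI Kred _ _ KSx) => //; exact: subset_trans KI.
move=> /(Smin _ (@subDsetl _ _ _)) SxS.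
have [_] : (S `\ x) x by rewrite SxS.
exact.
Qed.

End Ideals.

Theorem lemma2p2 (R : comNzRingType) (m : set R) (cl : set R -> set R)
    (hnoeth : noetherian R) (hloc : local_ring m)
    (hcl : nakayama_closure m cl)
    (I J : set R) (hI : is_ideal I) (hJ : cl_reduction cl J I) :
  (exists K : set R, minimal_cl_reduction cl K I /\ K `<=` J) /\
  (forall K : set R, minimal_cl_reduction cl K I -> K `<=` J ->
    forall S : set R, minimal_generating_set S K ->
    exists T : set R, S `<=` T /\ minimal_generating_set T J).
Proof.
have [hJi JI _] := hJ; split; first exact: exists_minimal_cl_reduction hnoeth hloc hcl hI hJ.
by move=> K Kmin KJ S; exact: extend_minimal_generating_set hnoeth hloc hcl hI hJi JI Kmin KJ.
Qed.
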